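(* Let $\mathcal{X}\in\mathbb{X}$. Then $\mathcal{X}$ is a Heine-Borel locally finite measure space (i.e. $\mathcal{X}\in\mathbb{X}_{\mathrm{HB}}$) if and only if it satisfies the local lower mass-bound property, i.e. $\mathfrak{m}_\delta^R(\mathcal{X})>0$ for all $R>\delta>0$.
   Context: A (pointed, complete, separable) metric measure space $(X,r,\rho,\mu)$ consists of a complete separable metric space $(X,r)$, a point $\rho\in X$ (the root) and a Borel measure $\mu$ on $X$; it is boundedly finite if $\mu$ is finite on all bounded sets. Two metric measure spaces are equivalent if there is a (surjective) isometry $\phi\colon\operatorname{supp}(\mu)\cup\{\rho\}\to\operatorname{supp}(\mu')\cup\{\rho'\}$ with $\phi(\rho)=\rho'$ and $\phi_*\mu=\mu'$. $\mathbb{X}$ is the set of equivalence classes of metric boundedly finite measure spaces; $\mathbb{X}_{\mathrm{HB}}\subseteq\mathbb{X}$ is the subset of classes containing a representative with $(X,r)$ a Heine-Borel space (every bounded closed set is compact). Lower mass function: $\mathfrak{m}_\delta^R((X,r,\rho,\mu)):=\inf\{\mu(\overline{B}_r(x,\delta)):x\in B_r(\rho,R)\cap\operatorname{supp}(\mu)\}$, with $B_r$, $\overline{B}_r$ open and closed balls and $\inf\emptyset=\infty$. *)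

(* Defs.v *)
From HB Require Import structures.
From mathcomp Require Import all_boot all_order all_algebra.
From mathcomp Require Import all_classical all_reals all_analysis.

Set Implicit Arguments.
Unset Strict Implicit.
Unset Printing Implicit Defensive.

Import Order.TTheory GRing.Theory Num.Theory.

Local Open Scope classical_set_scope.
Local Open Scope ring_scope.

(* The library's `Complete` also carries a distinguished point of the type; it
   only witnesses nonemptiness here and plays no role as a root. *)
#[short(type="completeMetricType")]
HB.structure Definition CompleteMetric (R : numDomainType) :=
  {T of Metric R T & Complete T}.

Notation borel X := (g_sigma_algebraType (@open X)).

Section MetricNotions.
Context {R : realType}.

Definition separable (X : topologicalType) : Prop :=
  exists2 D : set X, countable D & dense D.

(* `bounded_set` of the library is only available in normed modules. *)
Definition metric_bounded (X : metricType R) (A : set X) : Prop :=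
  exists (x : X) (M : R), A `<=` [set y | mdist x y <= M].

(* Not the library's `closed_ball`, which is the closure of the open ball. *)
Definition mclosed_ball (X : metricType R) (x : X) (d : R) : set X :=
  [set y | mdist x y <= d].

Definition heine_borel (X : metricType R) : Prop :=
  forall A : set X, metric_bounded A -> closed A -> compact A.

Definition msupport (X : completeMetricType R)
    (mu : {measure set (borel X) -> \bar R}) : set X :=
  [set x | forall U : set X, open U -> U x -> (0 < mu U)%E].

End MetricNotions.

Record mmspace (R : realType) := MMSpace {
  mm_carrier :> completeMetricType R ;
  mm_root : mm_carrier ;
  mm_measure : {measure set (borel mm_carrier) -> \bar R} ;
  mm_separable : separable mm_carrier ;
  mm_boundedly_finite : forall A : set (borel mm_carrier),
    measurable A -> metric_bounded (A : set mm_carrier) ->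
    (mm_measure A < +oo)%E }.

Section Equivalence.
Context {R : realType}.
Implicit Types X Y Z : mmspace R.

Definition mm_core X : set X := msupport (mm_measure X) `|` [set mm_root X].
Arguments mm_core : clear implicits.

(* An isometry of the cores is encoded as a total map whose values outside the
   core of X are irrelevant; its push-forward of the measure of X is then
   B |-> mm_measure X (mm_core X `&` phi @^-1` B). *)
Definition mm_isometry X Y (phi : X -> Y) : Prop :=
  [/\ phi (mm_root X) = mm_root Y,
      forall x y, mm_core X x -> mm_core X y ->
        mdist (phi x) (phi y) = mdist x y,
      phi @` mm_core X = mm_core Y &
      forall B : set (borel Y), measurable B ->
        mm_measure Y B = mm_measure X (mm_core X `&` phi @^-1` B)].

Definition mm_equiv X Y : Prop := exists phi : X -> Y, mm_isometry phi.

Definition mm_lower_mass (d r : R) X : \bar R :=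
  ereal_inf [set mm_measure X (mclosed_ball x d) |
             x in ball (mm_root X) r `&` msupport (mm_measure X)].

Lemma mball_open (T : metricType R) (x : T) (e : R) : open (ball x e).
Proof.
rewrite openE => y; rewrite ballEmdist /= => xy.
apply/nbhs_ballP; exists (e - mdist x y); first by rewrite /= subr_gt0.
move=> z; rewrite !ballEmdist /= ltrBrDl => yz.
exact: le_lt_trans (metric_triangle x y z) _.
Qed.

Lemma borel_open (T : completeMetricType R) (U : set T) :
  open U -> measurable (U : set (borel T)).
Proof. exact: sub_sigma_algebra. Qed.

Lemma borel_closed (T : completeMetricType R) (F : set T) :
  closed F -> measurable (F : set (borel T)).
Proof.
move=> cF; rewrite -[F]setCK; apply: (@measurableC _ (borel T)).
by apply: borel_open; rewrite openC.
Qed.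

Lemma mclosed_ball_closed (T : metricType R) (x : T) (e : R) :
  closed (mclosed_ball x e).
Proof.
rewrite -[mclosed_ball x e]setCK closedC openE => y /= /negP.
rewrite -ltNge => xy.
apply/nbhs_ballP; exists (mdist x y - e); first by rewrite /= subr_gt0.
move=> z; rewrite ballEmdist /= => yz; apply/negP; rewrite -ltNge.
rewrite -(ltrD2r (mdist y z)); apply: (@lt_le_trans _ _ (mdist x y)).
  by rewrite -ltrBrDl.
by rewrite [mdist y z]metric_sym; exact: metric_triangle.
Qed.

Lemma msupport_closed (T : completeMetricType R)
  (mu : {measure set (borel T) -> \bar R}) : closed (msupport mu).
Proof.
rewrite -[msupport mu]setCK closedC openE => x /=.
move=> /existsNP[U] /not_implyP[oU] /not_implyP[Ux muU].
apply: (filterS _ (open_nbhs_nbhs (conj oU Ux))) => y Uy sy.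
exact/muU/sy.
Qed.

Lemma mm_core_closed X : closed (mm_core X).
Proof.
apply: closedU; first exact: msupport_closed.
exact/accessible_closed_set1/hausdorff_accessible/metric_hausdorff.
Qed.

Lemma mm_core_measurable X : measurable (mm_core X : set (borel X)).
Proof. by apply: borel_closed; exact: mm_core_closed. Qed.

Lemma msupport_full X : mm_measure X (~` msupport (mm_measure X)) = 0%E.
Proof.
set mu := mm_measure X.
have mS : measurable (~` msupport mu : set (borel X)).
  by apply: borel_open; rewrite openC; exact: msupport_closed.
apply/negligibleP; first exact: mS.
have [D /countable_injP[f finj] dD] := mm_separable X.
pose F (n k : nat) : set (borel X) :=
  [set y : X | exists2 x, D x /\ f x = n &
    ball x k.+1%:R^-1 y /\ mu (ball x k.+1%:R^-1) = 0%E].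
have nF n k : mu.-negligible (F n k).
  have [[x [[Dx fx] m0]]|nx] := pselect (exists x,
      (D x /\ f x = n) /\ mu (ball x k.+1%:R^-1) = 0%E).
    exists (ball x k.+1%:R^-1); split => //.
      by apply: borel_open; exact: mball_open.
    move=> y [z [Dz fz] [zy _]].
    by rewrite (_ : x = z)//; apply: finj; rewrite ?inE// fx fz.
  suff -> : F n k = set0 by exact: negligible_set0.
  by apply/seteqP; split => // y [x Dx [_ m0]]; apply: nx; exists x.
have nFF : mu.-negligible (\bigcup_n \bigcup_k F n k).
  by apply: negligible_bigcup => n; apply: negligible_bigcup => k.
apply: negligibleS nFF.
move=> x /= /existsNP[U] /not_implyP[oU] /not_implyP[Ux /negP muU].
have mU : mu U = 0%E.
  by apply/eqP; rewrite eq_le measure_ge0 andbT leNgt.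
have /nbhs_ballP[e /= e0 eU] := open_nbhs_nbhs (conj oU Ux).
have [k] : exists k : nat, k.+1%:R^-1 < e / 2.
  have := @near_infty_natSinv_lt R (PosNum (divr_gt0 e0 (ltr0Sn _ 1))).
  by move=> [k _ /(_ k (leqnn k)) kP]; exists k.
move=> ke.
have [d [/= xd Dd]] : ball x (k.+1%:R^-1 : R) `&` D !=set0.
  apply: dD; last exact: mball_open.
  by exists x; apply: ballxx; rewrite invr_gt0.
exists (f d) => //; exists k => //; exists d => //; split.
  exact: ball_sym.
apply/eqP; rewrite eq_le measure_ge0 andbT -mU.
apply: le_measure; rewrite ?inE; [by apply: borel_open; exact: mball_open|exact: borel_open|].
move=> y dy; apply: eU; apply: le_ball (ball_triangle xd dy).
by rewrite [leRHS]splitr lerD// ltW.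
Qed.

Lemma msupport_capE X (S A : set (borel X)) :
  msupport (mm_measure X) `<=` S -> measurable S -> measurable A ->
  mm_measure X (S `&` A) = mm_measure X A.
Proof.
move=> sS mS mA.
have mSC : measurable (~` S) by exact: measurableC.
rewrite -[in RHS](setTI A) -(setUv S) setIUl measureU; last 3 first.
- exact: measurableI.
- exact: measurableI.
- by rewrite setIACA setICr set0I.
rewrite [Z in (_ + Z)%E](_ : _ = 0%E) ?adde0//.
apply/eqP; rewrite eq_le measure_ge0 andbT -(msupport_full X).
apply: le_measure; rewrite ?inE.
- exact: measurableI.
- by apply: borel_open; rewrite openC; exact: msupport_closed.
- by move=> x [nS _] /sS.
Qed.

Lemma mm_core_full X (A : set (borel X)) : measurable A ->
  mm_measure X (mm_core X `&` A) = mm_measure X A.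
Proof.
by apply: msupport_capE; [exact: subsetUl|exact: mm_core_measurable].
Qed.

Lemma mm_core_preimage X Y (phi : X -> Y) (B : set (borel Y)) :
  (forall x y, mm_core X x -> mm_core X y ->
    mdist (phi x) (phi y) = mdist x y) ->
  measurable B -> measurable (mm_core X `&` phi @^-1` B : set (borel X)).
Proof.
move=> iphi; apply: (@smallest_sub _ (sigma_algebra setT) (@open Y)
  [set B | measurable (mm_core X `&` phi @^-1` B : set (borel X))]).
  split => /=.
  - by rewrite preimage_set0 setI0; exact: measurable0.
  - move=> A mA; rewrite setTD preimage_setC.
    rewrite (_ : _ `&` _ = mm_core X `\` (mm_core X `&` phi @^-1` A)).
      by apply: measurableD => //; exact: mm_core_measurable.
    by rewrite setDIr setDv set0U.
  - move=> F mF; rewrite preimage_bigcup setI_bigcupr.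
    exact: bigcup_measurable.
move=> U oU /=.
pose V := \bigcup_(p in [set p : X * R |
  mm_core X p.1 /\ ball (phi p.1) p.2 `<=` U]) ball p.1 p.2.
rewrite (_ : _ `&` _ = mm_core X `&` V).
  apply: measurableI; first exact: mm_core_measurable.
  by apply: borel_open; apply: bigcup_open => p _; exact: mball_open.
apply/seteqP; split => x [cx].
  move=> Ux; split => //.
  have /nbhs_ballP[e /= e0 eU] := open_nbhs_nbhs (conj oU Ux).
  by exists (x, e) => //=; exact: ballxx.
case=> -[y e] /= [cy eU]; rewrite ballEmdist /= => yx; split => //=.
by apply: eU; rewrite ballEmdist /= iphi.
Qed.

Lemma mm_equiv_refl X : mm_equiv X X.
Proof.
exists id; split => //; first by rewrite image_id.
by move=> B mB; rewrite preimage_id mm_core_full.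
Qed.

Lemma mm_equiv_sym X Y : mm_equiv X Y -> mm_equiv Y X.
Proof.
move=> [phi [phi0 iphi sphi mphi]].
have /choice[psi psiP] : forall y, exists x, mm_core Y y ->
    mm_core X x /\ phi x = y.
  move=> y; have [|ny] := pselect (mm_core Y y); last by exists (mm_root X).
  by rewrite -sphi => -[x cx <-]; exists x.
have psiK x : mm_core X x -> psi (phi x) = x.
  move=> cx; have [|cpx eq] := psiP (phi x).
    by rewrite -sphi; exists x.
  by apply: (@mdist_positivity R); rewrite -iphi// eq mdistxx.
have ipsi x y : mm_core Y x -> mm_core Y y ->
    mdist (psi x) (psi y) = mdist x y.
  move=> /psiP[cx ex] /psiP[cy ey].
  by rewrite -iphi// ex ey.
exists psi; split => //.
- by rewrite -phi0 psiK//; right.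
- apply/seteqP; split => [_ [y /psiP[cy _] <-]//|x cx].
  by exists (phi x); [rewrite -sphi; exists x|exact: psiK].
- move=> A mA; rewrite mphi; last exact: mm_core_preimage.
  rewrite -[LHS]mm_core_full//; congr (mm_measure X _).
  apply/seteqP; split => x [cx] /=.
    by move=> Ax; split => //; rewrite psiK//; split => //; rewrite -sphi; exists x.
  by rewrite psiK// => -[].
Qed.

Lemma mm_equiv_trans X Y Z : mm_equiv X Y -> mm_equiv Y Z -> mm_equiv X Z.
Proof.
move=> [f [f0 fi fs fm]] [g [g0 gi gs gm]].
have cf x : mm_core X x -> mm_core Y (f x) by rewrite -fs => cx; exists x.
exists (g \o f); split.
- by rewrite /= f0.
- by move=> x y cx cy /=; rewrite gi ?fi//; exact: cf.
- by rewrite -image_comp fs.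
- move=> B mB; rewrite gm// fm; last exact: mm_core_preimage.
  congr (mm_measure X _); apply/seteqP; split => x [cx] /=.
    by case.
  by move=> Bx; split => //; split => //; exact: cf.
Qed.

Lemma mm_isometry_support X Y (phi : X -> Y) : mm_isometry phi ->
  forall x, msupport (mm_measure X) x -> msupport (mm_measure Y) (phi x).
Proof.
move=> [_ iphi _ mphi] x sx U oU Ux.
have cx : mm_core X x by left.
rewrite mphi; last exact: borel_open.
have /nbhs_ballP[e /= e0 eU] := open_nbhs_nbhs (conj oU Ux).
apply: (lt_le_trans (sx _ (mball_open x e) (ballxx x e0))).
rewrite -mm_core_full; last by apply: borel_open; exact: mball_open.
apply: le_measure; rewrite ?inE.
- apply: measurableI; first exact: mm_core_measurable.
  by apply: borel_open; exact: mball_open.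
- by apply: mm_core_preimage => //; exact: borel_open.
- move=> y [cy]; rewrite ballEmdist /= => xy; split => //=.
  by apply: eU; rewrite ballEmdist /= iphi.
Qed.

Lemma mm_lower_mass_le X Y (d r : R) : mm_equiv X Y ->
  (mm_lower_mass d r Y <= mm_lower_mass d r X)%E.
Proof.
move=> [phi isophi]; have sphi := mm_isometry_support isophi.
case: isophi => [phi0 iphi _ mphi].
apply: ereal_inf_le_tmp; move=> _ [x [xr sx] <-].
have cx : mm_core X x by left.
exists (phi x).
  split; last exact: sphi.
  move: xr; rewrite !ballEmdist /= -phi0 iphi//; by right.
rewrite mphi; last by apply: borel_closed; exact: mclosed_ball_closed.
rewrite -[RHS]mm_core_full; last by apply: borel_closed; exact: mclosed_ball_closed.
congr (mm_measure X _); apply/seteqP; split => y [cy];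
  by rewrite /mclosed_ball /= iphi.
Qed.

Lemma mm_lower_mass_equiv X Y (d r : R) : mm_equiv X Y ->
  mm_lower_mass d r X = mm_lower_mass d r Y.
Proof.
move=> XY; apply/eqP; rewrite eq_le !mm_lower_mass_le//.
exact: mm_equiv_sym.
Qed.

End Equivalence.
Arguments mm_core {R} X _.

(* An equivalence class is literally a class of spaces. MathComp's generic
   quotients are avoided: they would make mmspace R a choiceType, which forces
   the carriers of the spaces into a universe too small for, e.g., R^o. *)
Record mmclass (R : realType) := MMClass {
  mm_representative :> mmspace R -> Prop ;
  mmclassP : exists X : mmspace R, mm_representative = mm_equiv X }.

Section Classes.
Variable R : realType.
Implicit Types (X Y : mmspace R) (x : mmclass R).

Definition mmclass_of X : mmclass R :=
  MMClass (ex_intro (fun Y => mm_equiv X = mm_equiv Y) X erefl).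

Definition mm_repr x : mmspace R := sval (cid (mmclassP x)).

Definition mmclass_HB x : Prop :=
  exists X, mm_representative x X /\ heine_borel X.

(* Independent of the representative, see `lower_massE`. *)
Definition lower_mass (d r : R) x : \bar R := mm_lower_mass d r (mm_repr x).

Lemma mm_reprP x X : mm_representative x X <-> mm_equiv (mm_repr x) X.
Proof. by rewrite {1}(svalP (cid (mmclassP x))). Qed.

Lemma mmclass_ofP X Y : mmclass_of X = mmclass_of Y <-> mm_equiv X Y.
Proof.
split=> [XY|XY].
  have : mm_representative (mmclass_of Y) Y by exact: mm_equiv_refl.
  by rewrite -XY.
have e : mm_equiv X = mm_equiv Y.
  apply/funext => Z; apply/propext; split => [|YZ].
    exact/mm_equiv_trans/mm_equiv_sym.
  exact: mm_equiv_trans XY YZ.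
rewrite /mmclass_of; move: (ex_intro _ X _) (ex_intro _ Y _).
by rewrite e => p q; congr MMClass; exact: Prop_irrelevance.
Qed.

Lemma lower_massE (d r : R) x X : mm_representative x X ->
  lower_mass d r x = mm_lower_mass d r X.
Proof. by move=> /mm_reprP; exact: mm_lower_mass_equiv. Qed.

End Classes.

(* Main.v *)
Require Import Defs.
From HB Require Import structures.
From mathcomp Require Import all_boot all_order all_algebra.
From mathcomp Require Import all_classical all_reals all_analysis.

(** Lower masses are the same for equivalent spaces, and every space is
    equivalent to its core, the closed subspace consisting of supp(mu) and the
    root.  So the statement splits into two facts about single spaces, one about
    any Heine-Borel space and one about a space equal to its core.

    If bounded closed sets are compact, then so is the part of supp(mu) in the
    closed ball of radius R about the root.  Around each of its points x the
    ball of radius d/2 has positive mass, and the closed d-ball of every nearby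
    point contains it: the mass of d-balls is bounded below locally, hence
    uniformly on a compact set ([heine_borel_lower_mass]).

    Conversely, let L > 0 be the lower mass at radius d.  Any points of
    supp(mu) in the ball of radius R about the root that are more than 2d apart
    have disjoint closed d-balls, each of mass at least L, all lying in one ball
    of finite mass; there are finitely many of them, and a maximal family is
    a 2d-net ([lower_mass_net]).  Thus bounded parts of supp(mu) are totally
    bounded, and their closed subsets are compact by completeness
    ([lower_mass_heine_borel]).  Nothing is known about points off the support:
    a representative may have a bounded closed non-compact part of measure zero.
    The Heine-Borel representative is therefore the core itself, with the image
    of mu as measure ([core_space], [core_space_equiv]). *)

Import Order.TTheory GRing.Theory Num.Theory.
Local Open Scope classical_set_scope.
Local Open Scope ring_scope.

Set Implicit Arguments.
Unset Strict Implicit.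
Unset Printing Implicit Defensive.

(** * Heine-Borel spaces have positive lower masses *)

(** The bound is found as a real m close to 0 on the right: each point x admits
    the bound m, for all small m, on a whole neighbourhood, and near-covering
    compactness makes one m valid everywhere. *)
Lemma heine_borel_lower_mass (R : realType) (X : mmspace R) (d r : R) :
  heine_borel X -> 0 < d -> (0 < mm_lower_mass d r X)%E.
Proof.
move=> hbX d0; set mu := mm_measure X.
pose K : set X := msupport mu `&` mclosed_ball (mm_root X) r.
have cK : compact K.
  apply: hbX; first by exists (mm_root X), r => x [].
  by apply: closedI; [exact: msupport_closed|exact: mclosed_ball_closed].
have d20 : 0 < d / 2 by rewrite divr_gt0.
have [m [m0 mK]] : exists m : R, 0 < m /\
    forall x, K x -> (m%:E <= mu (mclosed_ball x d))%E.
  have nK : \forall m \near (0 : R)^'+, forall x, K x ->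
      (m%:E <= mu (mclosed_ball x d))%E.
    move/compact_near_coveringP : cK => /(_ R ((0 : R)^'+)
      (fun m x => (m%:E <= mu (mclosed_ball x d))%E)); apply => x [sx _].
    have bx0 := sx _ (mball_open x (d / 2)) (ballxx x d20).
    exists (ball x (d / 2), [set m | (m%:E <= mu (ball x (d / 2)))%E]) => /=.
      split; first exact: nbhsx_ballx.
      case: (mu (ball x (d / 2))) bx0 => [b|_|//]; last first.
        by near=> m; rewrite /= leey.
      rewrite lte_fin => b0; near=> m; rewrite /= lee_fin.
      by near: m; exact: nbhs_right_le.
    move=> [y m] /= [xy mb]; apply: (le_trans mb).
    apply: le_measure; rewrite ?inE.
    - by apply: borel_open; exact: mball_open.
    - by apply: borel_closed; exact: mclosed_ball_closed.
    - move=> z xz; have := ball_triangle (ball_sym xy) xz.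
      by rewrite -splitr ballEmdist => /ltW.
  near (0 : R)^'+ => m; exists m; split.
    by near: m; exact: nbhs_right_gt.
  by near: m.
apply: (@lt_le_trans _ _ m%:E); first by rewrite lte_fin.
apply/ereal_infP => _ [x [xr sx] <-]; apply: mK; split => //.
by move: xr; rewrite ballEmdist => /ltW.
Unshelve. all: by end_near. Qed.

(** * Positive lower masses yield finite nets *)

(** If an ultrafilter on A contained none of the e-balls, it would contain their
    complements, hence the complement of a finite cover of A; so it contains
    arbitrarily small balls, i.e. it is Cauchy. *)
Lemma totally_bounded_compact (R : realType) (T : completeMetricType R)
    (A : set T) :
  closed A ->
  (forall e : R, 0 < e ->
    exists s : seq T, forall x, A x -> exists2 y, y \in s & ball y e x) ->
  compact A.
Proof.
move=> cA netA; rewrite compact_ultra => F UF FA.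
have cF : cauchy F.
  apply: cauchy_exP => e e0; have [s sA] := netA _ e0.
  apply: contrapT => /forallNP nF.
  have Fs : F [set x | forall y, y \in s -> ~ ball y e x].
    elim: s {sA} => [|a s IHs]; first by apply: filterS filterT.
    have [/nF//|Fa] := in_ultra_setVsetC (ball a e) UF.
    apply: filterS2 Fa IHs => x ax xs y.
    by rewrite inE => /predU1P[->//|/xs].
  have [x [Ax xs]] := filter_ex (filterI FA Fs).
  by have [y ys] := sA _ Ax; exact: xs.
exists (lim F); split; last exact: cauchy_cvg.
exact: (closed_cvg A cA FA _ (cauchy_cvg F cF)).
Qed.

(** Without a finite net, a finite set of points can always be enlarged by a
    point further than 2d from all of them.  Each step adds a disjoint closed
    d-ball, so the mass of the union grows at least linearly, beyond that of
    the ball which contains all these unions. *)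
Lemma lower_mass_net (R : realType) (X : mmspace R) (d r : R) :
  0 < d -> (0 < mm_lower_mass d r X)%E ->
  exists s : seq X, forall x,
    (ball (mm_root X) r `&` msupport (mm_measure X)) x ->
    exists2 y, y \in s & mdist y x <= d + d.
Proof.
move=> d0; set mu := mm_measure X; set A := _ `&` _ => L0.
have [m m0 mA] : exists2 m : R, 0 < m &
    forall x, A x -> (m%:E <= mu (mclosed_ball x d))%E.
  have LA x : A x -> (mm_lower_mass d r X <= mu (mclosed_ball x d))%E.
    by move=> Ax; apply: ereal_inf_lbound; exists x.
  case: (mm_lower_mass d r X) L0 LA => [m m0 LA||]//; first by exists m.
  by move=> _ LA; exists 1 => // x /LA; apply: le_trans; exact: leey.
apply: contrapT => /forallNP noNet.
pose U (s : seq X) : set (borel X) :=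
  [set z : X | exists2 y, y \in s & mdist y z <= d].
have grow n : exists2 s : seq X, {in s, forall y, A y} &
    measurable (U s) /\ ((n%:R * m)%:E <= mu (U s))%E.
  elim: n => [|n [s sA [mU leU]]].
    exists [::] => //; split; last by rewrite mul0r measure_ge0.
    rewrite (_ : U [::] = set0) ?measurable0//.
    by apply/seteqP; split => // z [].
  have /existsNP[x /not_implyP[Ax farx]] := noNet s.
  have mx : measurable (mclosed_ball x d : set (borel X)).
    by apply: borel_closed; exact: mclosed_ball_closed.
  have UE : U (x :: s) = mclosed_ball x d `|` U s.
    apply/seteqP; split => [z [y]|z [xz|[y ys yz]]].
    - by rewrite inE => /predU1P[->|ys] yz; [left|right; exists y].
    - by exists x; rewrite ?mem_head.
    - by exists y; rewrite ?inE ?ys ?orbT.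
  exists (x :: s).
    by move=> y; rewrite inE => /predU1P[->//|/sA].
  rewrite UE; split; first exact: measurableU.
  rewrite measureU//.
    by rewrite -natr1 mulrDl mul1r addrC EFinD leeD ?mA.
  apply/seteqP; split => // z [xz [y ys yz]]; apply: farx; exists y => //.
  apply: (le_trans (metric_triangle y z x)); apply: lerD => //.
  by rewrite metric_sym.
pose B : set (borel X) := mclosed_ball (mm_root X) (r + d).
have mB : measurable B by apply: borel_closed; exact: mclosed_ball_closed.
have Boo : (mu B < +oo)%E.
  by apply: mm_boundedly_finite => //; exists (mm_root X), (r + d).
have Bfin : mu B \is a fin_num by rewrite ge0_fin_numE.
have [s sA [mU]] := grow (Num.bound (fine (mu B) / m)).
apply/negP; rewrite -ltNge; apply: (@le_lt_trans _ _ (mu B)).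
  apply: le_measure; rewrite ?inE// => z [y /sA[+ _] yz].
  rewrite ballEmdist => /ltW ry.
  by apply: (le_trans (metric_triangle _ y _)); exact: lerD.
rewrite -(fineK Bfin) lte_fin -ltr_pdivrMr//.
apply: archi_boundP; apply: divr_ge0; last exact: ltW.
exact: fine_ge0.
Qed.

(** Since every point other than the root lies in the support, nets of balls in
    the support become nets of balls in the whole space once the root is
    added. *)
Lemma lower_mass_heine_borel (R : realType) (X : mmspace R) :
  mm_core X = setT ->
  (forall d r : R, 0 < d -> d < r -> (0 < mm_lower_mass d r X)%E) ->
  heine_borel X.
Proof.
move=> coreX lmX A [a [M AM]] cA; apply: totally_bounded_compact => // e e0.
pose r := Num.max (mdist (mm_root X) a + M + 1) e.
(* The lower mass at radius e / 4 gives nets of mesh e / 2, small enough for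
   open e-balls; the maximum with e ensures e / 4 < r. *)
have d0 : 0 < e / 4 by rewrite divr_gt0.
have dr : e / 4 < r.
  by rewrite lt_max [X in _ || X]ltr_pdivrMr// ltr_pMr// ltr1n orbT.
have [s sP] := lower_mass_net d0 (lmX _ _ d0 dr).
exists (mm_root X :: s) => x Ax.
have : mm_core X x by rewrite coreX.
case=> [sx|->]; last by exists (mm_root X); rewrite ?mem_head//; exact: ballxx.
have [|y ys yx] := sP x.
  split => //; rewrite ballEmdist /= lt_max; apply/orP; left.
  rewrite (le_lt_trans (metric_triangle _ a _))// -addrA ltrD2l.
  by rewrite (le_lt_trans (AM _ Ax))// ltrDl.
exists y; first by rewrite inE ys orbT.
rewrite ballEmdist /= (le_lt_trans yx)//.
by rewrite -mulrDl ltr_pdivrMr// -[e + e]mulr2n -[e *+ 2]mulr_natr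
  ltr_pM2l// ltr_nat.
Qed.

(** * Closed subspaces of complete metric spaces *)

Section ClosedPart.
Context {R : realType} {T : completeMetricType R}.
Variables (A : set T) (a : T) (Aa : A a) (cA : closed A).

(** The proofs that A is closed and contains a are parameters of the type so
    that completeness and the base point can be declared as instances on it. *)
Definition closed_part of A a & closed A : Type := set_type A.
Local Notation S := (closed_part Aa cA).

HB.instance Definition _ := Choice.on S.

Definition closed_part_val (u : S) : T := set_val u.
Local Notation val := closed_part_val.

Definition closed_part_in (x : T) (Ax : A x) : S := SigSub (mem_set Ax).

Lemma closed_part_valP u : A (val u).
Proof. exact/set_mem/(svalP u). Qed.

Let dist (u v : S) : R := mdist (val u) (val v).

Let distxx u : dist u u = 0.
Proof. exact: mdistxx. Qed.

Let dist_positivity u v : dist u v = 0 -> u = v.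
Proof. by move=> /mdist_positivity; exact: val_inj. Qed.

Let dist_sym u v : dist u v = dist v u.
Proof. exact: metric_sym. Qed.

Let dist_triangle v u w : dist u w <= dist u v + dist v w.
Proof. exact: metric_triangle. Qed.

HB.instance Definition _ :=
  isMetric.Build R S distxx dist_positivity dist_sym dist_triangle.

Lemma closed_part_mdist (u v : S) : mdist u v = mdist (val u) (val v).
Proof. by []. Qed.

HB.instance Definition _ := isPointed.Build S (closed_part_in Aa).

Let cauchy_converges (F : set_system S) : ProperFilter F -> cauchy F -> cvg F.
Proof.
move=> PF /cauchyP cF.
have vF : cauchy (val @ F).
  apply: cauchy_exP => e e0; have [u Fu] := cF e e0.
  exists (val u); suff : F (val @^-1` ball (val u) e) by [].
  by apply: filterS Fu => v /=; rewrite !ballEmdist.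
have vFl : val @ F --> lim (val @ F) by exact: cauchy_cvg.
have Al : A (lim (val @ F)).
  apply: (closed_cvg A cA _ _ vFl); apply: filterS filterT => u _.
  exact: closed_part_valP.
apply/cvg_ex; exists (closed_part_in Al).
apply/cvg_ballP => e e0; move/cvg_ballP : vFl => /(_ _ e0).
by apply: filterS => u /=; rewrite !ballEmdist.
Qed.

HB.instance Definition _ := Uniform_isComplete.Build S cauchy_converges.

(** The points of a dense set D may all lie outside A.  They are replaced by
    points of A chosen in the balls of radius 1 / (k + 1) about them, where
    such points exist. *)
Lemma closed_part_separable : separable T -> separable S.
Proof.
move=> [D cD dD].
pose pick (p : T * nat) : S :=
  xget (closed_part_in Aa) [set u | ball p.1 p.2.+1%:R^-1 (val u)].
exists (pick @` (D `*` setT)).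
  apply: sub_countable (card_image_le _ _) _.
  exact: countableX.
move=> O [u Ou] oO.
have /nbhs_ballP[e /= e0 eO] := open_nbhs_nbhs (conj oO Ou).
have e20 : 0 < e / 2 by rewrite divr_gt0.
have [k ke] : exists k : nat, k.+1%:R^-1 < e / 2.
  have := @near_infty_natSinv_lt R (PosNum e20).
  by move=> [k _ /(_ k (leqnn k)) kP]; exists k.
have [d [/= ud Dd]] : ball (val u) (k.+1%:R^-1 : R) `&` D !=set0.
  apply: dD; last exact: mball_open.
  by exists (val u); apply: ballxx; rewrite invr_gt0.
have dp : ball d (k.+1%:R^-1 : R) (val (pick (d, k))).
  by apply: (@xgetPex _ (closed_part_in Aa)
    [set u | ball d k.+1%:R^-1 (val u)]); exists u; exact: ball_sym.
exists (pick (d, k)); split; last by exists (d, k).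
apply: eO; rewrite ballEmdist /= closed_part_mdist.
have := ball_triangle ud dp; rewrite ballEmdist => /lt_trans; apply.
by rewrite [ltRHS]splitr ltrD.
Qed.

End ClosedPart.

(** * The core of a metric measure space as a representative *)

Section CoreSpace.
Context {R : realType} (X : mmspace R).

Let rootP : mm_core X (mm_root X). Proof. by right. Qed.

Let closedP : closed (mm_core X). Proof. exact: mm_core_closed. Qed.

Local Notation S := (closed_part rootP closedP).
Local Notation val := (@closed_part_val R X _ _ rootP closedP).

(** Measures are pushed forward along total maps, whence the value at points off
    the core, which form a negligible set. *)
Definition core_retract (x : X) : S :=
  if pselect (mm_core X x) is left cx then closed_part_in rootP closedP cx
  else closed_part_in rootP closedP rootP.

Lemma core_retractK x : mm_core X x -> val (core_retract x) = x.
Proof. by rewrite /core_retract; case: pselect. Qed.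

Lemma core_valK u : core_retract (val u) = u.
Proof.
by apply/val_inj/core_retractK; exact: closed_part_valP.
Qed.

Lemma core_retract_isom x y : mm_core X x -> mm_core X y ->
  mdist (core_retract x) (core_retract y) = mdist x y.
Proof. by move=> cx cy; rewrite closed_part_mdist !core_retractK. Qed.

(** On the core the retraction is an isometry, for which preimages of Borel sets
    are Borel by [mm_core_preimage]; off the core it is constant. *)
Lemma core_retract_measurable :
  measurable_fun setT (core_retract : borel X -> borel S).
Proof.
move=> _ B mB; rewrite setTI.
(* [mm_core_preimage] is about a map between metric measure spaces; any
   measure on the target will do, e.g. the zero measure. *)
pose Y0 : mmspace R := @MMSpace R (S : completeMetricType R)
  (core_retract (mm_root X)) mzero
  (closed_part_separable rootP closedP (mm_separable X))
  (fun _ _ _ => ltry 0).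
have mc := @mm_core_measurable R X.
rewrite -[_ @^-1` B](@setUIDK _ _ (mm_core X)); apply: measurableU.
  rewrite setIC.
  exact: (mm_core_preimage (Y := Y0) core_retract_isom mB).
have outE x : ~ mm_core X x -> core_retract x = core_retract (mm_root X).
  move=> ncx; rewrite /core_retract; case: pselect => // _.
  by case: pselect => // cr; exact: val_inj.
have [Br|nBr] := pselect (B (core_retract (mm_root X))).
  rewrite (_ : _ `\` _ = ~` mm_core X); first exact: measurableC.
  by apply/seteqP; split => [x []//|x ncx]; split => //=; rewrite outE.
rewrite (_ : _ `\` _ = set0); first exact: measurable0.
by apply/seteqP; split => // x [Bx ncx]; case: nBr; rewrite -(outE x ncx).
Qed.

(** Since the complement of the core is negligible, pushing mu forward along the
    retraction amounts to restricting mu to the core. *)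
Definition core_measure : set (borel S) -> \bar R :=
  pushforward (mm_measure X) (core_retract : borel X -> borel S).

Let core_measure0 : core_measure set0 = 0%E.
Proof. by rewrite /core_measure /pushforward preimage_set0 measure0. Qed.

Let core_measure_ge0 B : (0 <= core_measure B)%E.
Proof. exact: (measure_ge0 (mm_measure X)). Qed.

Let core_measure_sigma_additive : semi_sigma_additive core_measure.
Proof.
apply: measure_semi_sigma_additive; exact: core_retract_measurable.
Qed.

HB.instance Definition _ := isMeasure.Build _ _ _ core_measure
  core_measure0 core_measure_ge0 core_measure_sigma_additive.

Let core_boundedly_finite (B : set (borel S)) : measurable B ->
  metric_bounded (B : set S) -> (core_measure B < +oo)%E.
Proof.
move=> mB [u [M uM]]; rewrite /core_measure /pushforward.
rewrite -mm_core_full; last first.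
  by rewrite -[_ @^-1` _]setTI; exact: core_retract_measurable.
have mM : measurable (mclosed_ball (val u) M : set (borel X)).
  by apply: borel_closed; exact: mclosed_ball_closed.
apply: le_lt_trans (mm_boundedly_finite mM _); last by exists (val u), M.
apply: le_measure; rewrite ?inE//.
  apply: measurableI; first exact: mm_core_measurable.
  by rewrite -[_ @^-1` _]setTI; exact: core_retract_measurable.
by move=> x [cx /uM] /=; rewrite closed_part_mdist core_retractK.
Qed.

Definition core_space : mmspace R := @MMSpace R (S : completeMetricType R)
  (core_retract (mm_root X)) core_measure
  (closed_part_separable rootP closedP (mm_separable X))
  core_boundedly_finite.

(** Balls about a support point of mu keep their mass in the core space. *)
Lemma core_space_core : mm_core core_space = setT.
Proof.
apply/seteqP; split => // u _.
case: (closed_part_valP u) => [su|ru]; last first.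
  by right; exact: etrans (esym (core_valK u)) (congr1 core_retract ru).
left => U oU Uu.
have /nbhs_ballP[e /= e0 eU] := open_nbhs_nbhs (conj oU Uu).
have mbu : measurable (ball (val u) e : set (borel X)).
  by apply: borel_open; exact: mball_open.
apply: (lt_le_trans (su _ (mball_open _ e) (ballxx _ e0))).
rewrite -mm_core_full//; apply: le_measure; rewrite ?inE.
- by apply: measurableI => //; exact: mm_core_measurable.
- rewrite -[_ @^-1` _]setTI.
  by apply: core_retract_measurable => //; exact: borel_open.
- move=> x [cx]; rewrite ballEmdist /= => ux; apply: eU.
  by rewrite ballEmdist /= closed_part_mdist core_retractK.
Qed.

Lemma core_space_equiv : mm_equiv X core_space.
Proof.
exists core_retract; split => //.
- exact: core_retract_isom.
- rewrite core_space_core; apply/seteqP; split => // u _.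
  by exists (val u); [exact: closed_part_valP|exact: core_valK].
- move=> B mB; rewrite mm_core_full//.
  by rewrite -[_ @^-1` _]setTI; exact: core_retract_measurable.
Qed.

End CoreSpace.

Unset Implicit Arguments.

Theorem lemma3p5 (R : realType) (x : mmclass R) :
  mmclass_HB x <->
  (forall d r : R, 0 < d -> d < r -> (0 < lower_mass d r x)%E).
Proof.
split=> [[X [xX hbX]] d r d0 _|lm].
  by rewrite (lower_massE d r xX); exact: heine_borel_lower_mass.
exists (core_space (mm_repr x)); split.
  by apply/mm_reprP; exact: core_space_equiv.
apply: lower_mass_heine_borel => [|d r d0 dr]; first exact: core_space_core.
rewrite -(mm_lower_mass_equiv d r (core_space_equiv (mm_repr x))).
exact: lm.
Qed.
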